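(* Let $q$ be even, $t\ge 3$ a prime, $q\ge t$. In $\mathrm{PG}(2,q^t)$, let $\mathcal C$ be a conic and let $\mathcal D$ be an André set of $\ell_\infty$. For $m\in\{1,\ldots,t-1\}$ perform an André replacement using the André replacement net $\mathcal D^m$, and let $\mathcal D_m(\mathcal C)$ denote the set of points in the André plane $\mathcal P(\mathcal D^m)$ corresponding to the affine points of $\mathcal C$. If $\mathcal C$ is either exterior or secant to $\ell_\infty$, then $\mathcal D_m(\mathcal C)$ is not an arc in $\mathcal P(\mathcal D^m)$ for any $m\in\{1,\ldots,t-1\}$.
   Context: Conics are non-degenerate. Homogeneous coordinates of $\mathrm{PG}(2,q^t)$ are $(x,y,z)$, with $\ell_\infty$ the line $z=0$; the point $(x,y,0)$ of $\ell_\infty\cong\mathrm{PG}(1,q^t)$ is also written $(x,y)$. Affine points are the points not on $\ell_\infty$; $(x,y,1)$ is identified with the vector $(x,y)\in V=\mathbb F_{q^t}^2$. A line is exterior, tangent, secant to a conic if it meets it in $0,1,2$ points respectively. An arc of a projective plane is a set of points, no three collinear. Norm: $\mathrm N(k)=k^{1+q+\cdots+q^{t-1}}$ for $k\in\mathbb F_{q^t}$. André sets: for distinct points $E,F$ of $\mathrm{PG}(1,q^t)$, let $G\le \mathrm{PGL}(2,q^t)$ be the group (cyclic of order $q^t-1$) of projectivities fixing both $E$ and $F$, and $H$ its unique subgroup of order $q^{t-1}+\cdots+q+1$. The $q-1$ orbits of $H$ on $\mathrm{PG}(1,q^t)\setminus\{E,F\}$ are the André sets with transversal points $E,F$. The André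 sets with transversal points $(1,0),(0,1)$ are $\mathcal A_\delta=\{(1,\theta)\mid \theta\in\mathbb F_{q^t}^*,\ \mathrm N(\theta)=\delta\}$, $\delta\in\mathbb F_q^*$, and every André set is the image of such a set under a projectivity. Bruck–Bose representation: regard $V$ as a $2t$-dimensional $\mathbb F_q$-space, so affine points of $\mathrm{PG}(2,q^t)$ are the points of $\mathrm{AG}(2t,q)$. A point $P=(x,y)$ of $\ell_\infty$ corresponds to the $t$-dimensional $\mathbb F_q$-subspace $[P]=\{(sx,sy)\mid s\in\mathbb F_{q^t}\}$ of $V$ (projectively a $(t-1)$-space of the hyperplane at infinity $\mathrm{PG}(2t-1,q)$); the affine lines through $P$ are the cosets of $[P]$. André replacement nets: for $\mathcal D=\mathcal A_\delta$ and $m\in\{1,\ldots,t-1\}$, $\mathcal D^m=\{X_{m,u}\mid u\in\mathbb F_{q^t}^*,\mathrm N(u)=\delta\}$ where $X_{m,u}=\{(s,s^{q^m}u)\mid s\in\mathbb F_{q^t}\}$, a $t$-dimensional $\mathbb F_q$-subspace of $V$. For a general André set $\mathcal D$, choose $\varphi\in\mathrm{GL}(2,q^t)$ inducing a projectivity mapping some $\mathcal A_\delta$ to $\mathcal D$; the $t-1$ replacement nets of $\mathcal D$ are $\mathcal D^m=\{\varphi(X_{m,u})\}$, the images of those of $\mathcal A_\delta$. André replacement: a $\mathcal D^m$-block is a coset in $V$ of a member of $\mathcal D^m$. The incidence structure whose points are the affine points of $\mathrm{PG}(2,q^t)$ and whose lines are the affine lines of $\mathrm{PG}(2,q^t)$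 meeting $\ell_\infty$ in a point not in $\mathcal D$, together with the $\mathcal D^m$-blocks, is an affine plane of order $q^t$; its projective completion is the André plane $\mathcal P(\mathcal D^m)$. *)

(* Defs.v *)
From HB Require Import structures.
From mathcomp Require Import all_boot all_fingroup all_order all_algebra.
Set Implicit Arguments.
Unset Strict Implicit.
Unset Printing Implicit Defensive.

Import GRing.Theory.
Local Open Scope ring_scope.

Section ProjectiveSpace.
Variables (K : finFieldType) (d : nat).

(* The points of PG(d, K) are the one-dimensional subspaces of K^(d+1), each
   represented by the canonical square matrix <<_>>%MS with that row space. *)
Record PG := Point {
  point_mx :> 'M[K]_(d.+1);
  _ : (\rank point_mx == 1)%N && (<<point_mx>>%MS == point_mx)
}.
HB.instance Definition _ := [isSub for point_mx].
HB.instance Definition _ := [Finite of PG by <:].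

Definition coords (P : PG) (v : 'rV[K]_(d.+1)) : bool :=
  point_mx P == <<v>>%MS.

Definition induces (g : 'M[K]_(d.+1)) (s : {perm PG}) : bool :=
  [forall P : PG, point_mx (s P) == <<P *m g>>%MS].

Definition PGL : {set {perm PG}} :=
  [set s | [exists g : 'M[K]_(d.+1), (g \in unitmx) && induces g s]].

End ProjectiveSpace.

Section Conics.
Variable K : finFieldType.

Definition hom3 (x y z : K) : 'rV[K]_3 := \row_(j < 3) [:: x; y; z]`_j.

(* The matrix A need not be symmetric, so that in every characteristic each
   ternary quadratic form is quad A for some A. *)
Definition quad (A : 'M[K]_3) (v : 'rV[K]_3) : K := (v *m A *m v^T) 0 0.

Definition polar (A : 'M[K]_3) (v w : 'rV[K]_3) : K :=
  quad A (v + w) - quad A v - quad A w.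

(* A singular vector is a zero of the form lying in the radical of its polar
   form; in characteristic 2 that radical is never trivial here, so
   nondegeneracy cannot be read off the polar form alone. *)
Definition nondegenerate (A : 'M[K]_3) : Prop :=
  forall v : 'rV[K]_3,
    quad A v = 0 -> (forall w : 'rV[K]_3, polar A v w = 0) -> v = 0.

Definition is_conic (C : {set PG K 2}) : Prop :=
  exists2 A : 'M[K]_3, nondegenerate A &
    C = [set P | [exists v : 'rV[K]_3, coords P v && (quad A v == 0)]].

Definition linf : {set PG K 2} :=
  [set P | [exists x : K, exists y : K, coords P (hom3 x y 0)]].

Definition exterior (C l : {set PG K 2}) : Prop := #|C :&: l| = 0%N.
Definition secant (C l : {set PG K 2}) : Prop := #|C :&: l| = 2%N.

Definition affine_part (C : {set PG K 2}) : {set 'rV[K]_2} :=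
  [set v : 'rV[K]_2 | [exists P in C, coords P (hom3 (v 0 0) (v 0 1) 1)]].

End Conics.

Section Andre.
(* Intended for #|K| = q ^ t; the subfield F_q is then {x | x ^+ q = x}. *)
Variables (q t : nat) (K : finFieldType).

Definition hom2 (x y : K) : 'rV[K]_2 := \row_(j < 2) [:: x; y]`_j.

Definition Nm (k : K) : K := k ^+ (\sum_(i < t) q ^ i)%N.

Definition fix2 (E F : PG K 1) : {set {perm PG K 1}} :=
  [set s in PGL K 1 | (s E == E) && (s F == F)].

Definition is_andre_set (D : {set PG K 1}) : Prop :=
  exists (E F P : PG K 1) (H : {group {perm PG K 1}}),
    [/\ E != F, H \subset fix2 E F, #|H| = (\sum_(i < t) q ^ i)%N,
        P \notin [set E; F] & D = orbit 'P H P].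

Definition andre_std (delta : K) : {set PG K 1} :=
  [set P | [exists theta : K,
     [&& theta != 0, Nm theta == delta & coords P (hom2 1 theta)]]].

Definition andre_block (m : nat) (u : K) : {set 'rV[K]_2} :=
  [set hom2 s (s ^+ (q ^ m)%N * u) | s : K].

Definition net_std (m : nat) (delta : K) : {set {set 'rV[K]_2}} :=
  [set andre_block m u | u : K & (u != 0) && (Nm u == delta)].

(* The net D^m depends on the chosen g and delta (exchanging the transversal
   points exchanges m and t - m); this relation admits every choice. *)
Definition is_replacement_net (D : {set PG K 1}) (m : nat)
    (N : {set {set 'rV[K]_2}}) : Prop :=
  exists (g : 'M[K]_2) (s : {perm PG K 1}) (delta : K),
    [/\ g \in unitmx, induces g s,
        (delta != 0) && (delta ^+ q == delta),
        D = s @: andre_std delta &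
        N = [set [set v *m g | v in Y : {set 'rV[K]_2}]
              | Y in net_std m delta]].

End Andre.

Section AndrePlane.
Variable K : finFieldType.

Definition spread_elt (P : PG K 1) : {set 'rV[K]_2} :=
  [set v | (v <= P)%MS].

Definition translate (v : 'rV[K]_2) (Y : {set 'rV[K]_2}) : {set 'rV[K]_2} :=
  [set v + w | w in Y].

Definition andre_affine_lines (D : {set PG K 1}) (N : {set {set 'rV[K]_2}}) :
    {set {set 'rV[K]_2}} :=
  [set l | [exists v : 'rV[K]_2, exists P,
             (P \notin D) && (l == translate v (spread_elt P))]]
  :|: [set l | [exists v : 'rV[K]_2, exists Y in N, l == translate v Y]].

End AndrePlane.

Section Completion.
Variables (T : finType) (L : {set {set T}}).

Definition parallel_class (l : {set T}) : {set {set T}} :=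
  [set k in L | (k == l) || [disjoint k & l]].

(* Points of the completion: inl x for an affine point x, inr c for the ideal
   point of a parallel class c. *)
Definition ideal_line : {set T + {set {set T}}} :=
  [set inr (parallel_class l) | l in L].

Definition extended_line (l : {set T}) : {set T + {set {set T}}} :=
  inr (parallel_class l) |: [set inl x | x in l].

Definition completion_lines : {set {set T + {set {set T}}}} :=
  ideal_line |: [set extended_line l | l in L].

End Completion.

Definition is_arc (T : finType) (lines : {set {set T}}) (S : {set T}) : Prop :=
  forall x y z : T, x \in S -> y \in S -> z \in S ->
    x != y -> y != z -> x != z ->
    ~ exists2 l, l \in lines & [/\ x \in l, y \in l & z \in l].

Section AndreProjectivePlane.
Variables (K : finFieldType) (D : {set PG K 1}) (N : {set {set 'rV[K]_2}}).

Definition andre_point : finType :=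
  ('rV[K]_2 + {set {set 'rV[K]_2}})%type.

Definition andre_plane_lines : {set {set andre_point}} :=
  completion_lines (andre_affine_lines D N).

Definition andre_points_of (C : {set PG K 2}) : {set andre_point} :=
  [set inl v | v in affine_part C].

End AndreProjectivePlane.

(* Main.v *)
Require Import Defs.
From mathcomp Require Import all_boot all_fingroup all_order all_algebra.
From mathcomp Require Import finfield ring zify.
Set Implicit Arguments.
Unset Strict Implicit.
Unset Printing Implicit Defensive.

Import GRing.Theory.

(* Put the nucleus of the conic at the origin, so that the affine conic is
   Q(x, y) = k with Q = a x^2 + b x y + c y^2, where b != 0 because the conic
   is not tangent to the line at infinity. Write e(s) = (s, s^(q^m) u) for the
   points of a block through the origin. At most 2q + 1 values of s give
   Q(e(s)) = 0, so there are s1, s2 with Q(e(s1)), Q(e(s2)), Q(e(s1 + s2)) and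
   the polar form B(e(s1), e(s2)) all nonzero. In characteristic 2 the point
   P = (Q(e2) e1 + Q(e1) e2) / B(e1, e2) then satisfies
   Q(P) = Q(P + e1) = Q(P + e2) = Q(e1) Q(e2) Q(e1 + e2) / B(e1, e2)^2.
   Scaling e1 and e2 by r in K^* only changes u to u r^(1 - q^m), which has the
   same norm, and multiplies this value by r^2; as every element is a square it
   can be made equal to k, and the translate by P of the block of u r^(1 - q^m)
   meets the conic in three points. *)

(** * Power maps and the norm on K, and zeros of a binary quadratic form on a block *)

Section Frobenius.
Local Open Scope ring_scope.
Variables (q t m : nat) (K : finFieldType).
Hypothesis cardK : #|K| = (q ^ t)%N.

Lemma pchar2_card_even : ~~ odd q -> (0 < t)%N -> 2%N \in [pchar K].
Proof.
move=> q_even t_gt0; have [p p_pr pK] := finPcharP K.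
have: (2 %| #|pPrimeCharType pK|)%N.
  by rewrite cardK dvdn2 oddX negb_or q_even -lt0n t_gt0.
rewrite card_pprimeChar Euclid_dvdX // => /andP[+ _].
by rewrite dvdn_prime2 // => /eqP ->.
Qed.

Lemma pnat_card_pchar p : (0 < t)%N -> p \in [pchar K] -> p.-nat q.
Proof.
move=> t_gt0 pK; have p_pr := pcharf_prime pK.
have: p.-nat (q ^ t)%N.
  by rewrite -cardK -[#|K|]/#|pPrimeCharType pK| card_pprimeChar pnatX pnat_id.
by rewrite pnatX; case/orP=> // /eqP t0; rewrite t0 in t_gt0.
Qed.

(** Every x is also fixed by the power q^t, so a Bezout relation between the coprime exponents m and
    t leaves x fixed by the power q. *)
Lemma exprq_fixed (x : K) : coprime m t -> (0 < m)%N ->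
  x ^+ (q ^ m) = x -> x ^+ q = x.
Proof.
have iterX y n k : y ^+ (q ^ n) = y -> y ^+ (q ^ (k * n)) = y :> K.
  move=> yn; elim: k => [|k IHk]; first by rewrite expr1.
  by rewrite mulSn expnD exprM yn.
move=> /eqP mt m_gt0 xm; case: (egcdnP t m_gt0) => k l; rewrite mt => kl _.
have := iterX _ _ k xm; rewrite kl addn1 expnSr exprM iterX //.
by rewrite -cardK expf_card.
Qed.

Lemma card_exprq_fixed : (1 < q)%N -> (#|[set x : K | x ^+ q == x]| <= q)%N.
Proof.
move=> q_gt1; have sizeP : size ('X^q - 'X : {poly K}) = q.+1.
  by rewrite size_polyDl ?size_polyXn // size_polyN size_polyX.
rewrite cardE -ltnS -sizeP; apply: max_poly_roots.
- by rewrite -size_poly_eq0 sizeP.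
- by apply/allP=> x; rewrite mem_enum inE rootE !hornerE subr_eq0.
- exact: enum_uniq.
Qed.

(** The quotient of two nonzero solutions is fixed by the power q^m, so dividing by one solution
    embeds all of them in the fixed set of the power q. *)
Lemma card_slope (u w : K) : coprime m t -> (0 < m)%N -> (1 < q)%N -> u != 0 ->
  (#|[set s : K | s != 0 & u * s ^+ (q ^ m) == w * s]%R| <= q)%N.
Proof.
move=> mt m_gt0 q_gt1 u0; set S := [set s | _].
have [->|[s0 s0S]] := set_0Vmem S; first by rewrite cards0.
apply: leq_trans (card_exprq_fixed q_gt1).
rewrite -(card_imset _ (mulIf (invr_neq0 (_ : s0 != 0)))); last first.
  by move: s0S; rewrite inE => /andP[].
apply/subset_leq_card/subsetP=> _ /imsetP[s sS ->]; rewrite inE.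
move: s0S sS; rewrite !inE => /andP[s00 /eqP e0] /andP[s_0 /eqP e].
apply/eqP/exprq_fixed => //; rewrite expr_div_n.
apply: (mulfI u0); apply: (mulIf s00); apply: (mulIf (expf_neq0 (q ^ m) s00)).
rewrite mulrA e; apply: (mulfI u0).
have -> : u * (w * s / s0 ^+ (q ^ m) * s0 * s0 ^+ (q ^ m)) = u * s * (w * s0).
  by field; rewrite expf_neq0.
by rewrite -e0; field.
Qed.

(** With n = 1 + q + ... + q^(t-1) one has n q + 1 = n + q^t, while x^(q^t) = x. *)
Lemma Nm_exprq (x : K) : x != 0 -> Nm q t x ^+ q = Nm q t x.
Proof.
move=> x0; apply: (mulIf x0); rewrite /Nm -exprM -exprSr.
have -> : ((\sum_(i < t) q ^ i) * q).+1 = (\sum_(i < t) q ^ i + q ^ t)%N.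
  transitivity (\sum_(i < t.+1) q ^ i)%N; last by rewrite big_ord_recr.
  rewrite big_ord_recl /= add1n big_distrl /=.
  by congr _.+1; apply: eq_bigr => i _; rewrite -expnSr.
by rewrite exprD -cardK expf_card.
Qed.

(** The norm of x is fixed by the power q^m, so x^(1 - q^m) has norm 1. This keeps a rescaled block
    in the same replacement net. *)
Lemma Nm_twist (u x : K) : x != 0 -> Nm q t (u * x / x ^+ (q ^ m)) = Nm q t u.
Proof.
move=> x0; have Nq n : Nm q t x ^+ (q ^ n) = Nm q t x.
  by elim: n => [|n IHn]; rewrite ?expr1 // expnS exprM Nm_exprq.
rewrite /Nm exprMn exprVn exprMn -[(x ^+ (q ^ m)) ^+ _]exprM [(q ^ m * _)%N]mulnC.
by rewrite exprM -/(Nm q t x) Nq mulfK // expf_neq0.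
Qed.

Lemma sqrt_exists (x : K) : 2%N \in [pchar K] -> exists y, x = y ^+ 2.
Proof.
move=> p2; have inj2 : injective (fun y : K => y ^+ 2).
  by move=> y z /eqP; rewrite -!(pFrobenius_autE p2) (inj_eq (fmorph_inj _)) => /eqP.
by have /codomP[y ->] := injF_onto inj2 x; exists y.
Qed.

Lemma card_slope_roots (a b c : K) : b != 0 ->
  (#|[set w : K | a + b * w + c * w ^+ 2 == 0]%R| <= 2)%N.
Proof.
move=> b0; pose p := \poly_(i < 3) [:: a; b; c]`_i.
have hp w : p.[w] = a + b * w + c * w ^+ 2.
  by rewrite horner_poly !big_ord_recl big_ord0 /=; ring.
have pb : p`_1%N = b by rewrite coef_poly.
have sp : (size p <= 3)%N by exact: size_poly.
clearbody p; rewrite cardE -ltnS; apply: leq_trans sp.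
apply: max_poly_roots.
(* The middle coefficient b keeps the polynomial nonzero even if a = c = 0. *)
- by apply: contraNneq b0 => p0; rewrite -pb p0 coef0.
- by apply/allP=> w; rewrite mem_enum inE rootE hp.
- exact: enum_uniq.
Qed.

(** For nonzero s, dividing the form by s^2 gives a + b w + c w^2 at the slope w = u s^(q^m) / s. At
    most two slopes are roots, each is attained by at most q values of s, and s = 0 adds one
    more. *)
Lemma card_quadric_block (a b c u : K) : coprime m t -> (0 < m)%N -> (1 < q)%N ->
  u != 0 -> b != 0 ->
  (#|[set s : K | a * s ^+ 2 + b * s * (s ^+ (q ^ m) * u)
                  + c * (s ^+ (q ^ m) * u) ^+ 2 == 0]%R| <= 1 + 2 * q)%N.
Proof.
move=> mt m_gt0 q_gt1 u0 b0.
set W := [set w : K | a + b * w + c * w ^+ 2 == 0].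
pose S w := [set s : K | s != 0 & u * s ^+ (q ^ m) == w * s].
have cardS : (#|\bigcup_(w in W) S w| <= 2 * q)%N.
  apply: (@leq_trans (\sum_(w in W) #|S w|)).
    elim/big_ind2: _ => [|A x B y Ax By|w _]; rewrite ?cards0 //.
    by apply: leq_trans (leq_add Ax By); rewrite leq_card_setU.
  apply: leq_trans (leq_mul (card_slope_roots a c b0) (leqnn q)).
  by rewrite -sum_nat_const leq_sum // => w _; apply: card_slope.
apply: (@leq_trans #|[set 0%R : K] :|: \bigcup_(w in W) S w|); last first.
  apply: leq_trans (leq_card_setU _ _) _.
  by rewrite cards1 leq_add2l.
apply/subset_leq_card/subsetP=> s; rewrite !inE => /eqP e.
have [//|s0] /= := eqVneq s 0.
apply/bigcupP; exists (u * s ^+ (q ^ m) / s); rewrite inE.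
  apply/eqP/(mulfI (expf_neq0 2 s0)); rewrite mulr0 -{}e.
  by move: (s ^+ (q ^ m)) => y; field.
by rewrite s0 divfK /=.
Qed.

Lemma exists_nonsingular_triangle (a b c u : K) :
    coprime m t -> (0 < m)%N -> (3 < q)%N -> (2 < t)%N -> u != 0 -> b != 0 ->
    let Q x y := a * x ^+ 2 + b * x * y + c * y ^+ 2 in
    let f s := s ^+ (q ^ m) * u in
  exists s1 s2, [/\ Q s1 (f s1) != 0, Q s2 (f s2) != 0,
    Q (s1 + s2) (f (s1 + s2)) != 0 & s1 * f s2 != s2 * f s1].
Proof.
move=> mt m_gt0 q_gt3 t_gt2 u0 b0 Q f.
have q_gt1 : (1 < q)%N by lia.
have qK : (q ^ 3 <= #|K|)%N by rewrite cardK leq_exp2l.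
have q3 : (q ^ 3 = q * (q * q))%N by rewrite !expnS expn0 muln1.
pose Z := [set s | Q s (f s) == 0].
have cardZ : (#|Z| <= 1 + 2 * q)%N by exact: card_quadric_block.
have avoid (B : {set K}) : (#|B| < q ^ 3)%N -> exists s, s \notin B.
  move=> cB; apply/existsP; rewrite -negb_forall; apply/negP => /forallP allB.
  have : (#|K| <= #|B|)%N by rewrite -cardsT subset_leq_card //; apply/subsetP.
  lia.
have Z0 : Q 0 (f 0) = 0.
  have qm0 : ((q ^ m)%N == 0%N) = false by rewrite expn_eq0; lia.
  by rewrite /Q /f [0 ^+ (q ^ m)]expr0n qm0 mulr0n; ring.
have [s1 s1Z] : exists s1, s1 \notin Z by apply: avoid; nia.
have s10 : s1 != 0.
  by apply: contraNneq s1Z => ->; rewrite inE Z0.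
(* The three sets exclude in turn that Q vanishes at s2, that it vanishes at s1 + s2, and that the
   block points of s1 and s2 are proportional. Their sizes add up to at most 2(1 + 2q) + q < q^3. *)
pose B := Z :|: [set s - s1 | s in Z] :|:
  [set s : K | s != 0 & s1 * s ^+ (q ^ m) == s1 ^+ (q ^ m) * s].
have [s2 s2B] : exists s2, s2 \notin B.
  apply: avoid; apply: leq_ltn_trans (leq_card_setU _ _) _.
  apply: (@leq_ltn_trans (#|Z| + #|Z| + q)).
    rewrite leq_add //; last exact: card_slope.
    apply: leq_trans (leq_card_setU _ _) _.
    by rewrite leq_add // leq_imset_card.
  nia.
exists s1, s2; move: s1Z s2B; rewrite !inE !negb_or => -> /andP[/andP[Z2 Z12] S2].
split=> //.
  apply: contra Z12 => Z12; apply/imsetP; exists (s1 + s2); rewrite ?inE //.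
  by rewrite addrAC subrr add0r.
apply: contra S2 => /eqP e; apply/andP; split.
  by apply: contraNneq Z2 => ->; rewrite Z0.
by apply/eqP/(mulIf u0); rewrite /= -!mulrA e mulrCA.
Qed.

End Frobenius.

(** * Inscribing a translated triangle in a level set of Q *)

Section Triangle.
Local Open Scope ring_scope.
Variables (K : fieldType) (a b c : K).
Hypothesis pcharK : 2%N \in [pchar K].
Let Q x y := a * x ^+ 2 + b * x * y + c * y ^+ 2.

(* The point (x, y) is the solution P of B(P, e1) = Q(e1), B(P, e2) = Q(e2),
   with e1 = (x1, y1), e2 = (x2, y2) and B the polar form of Q. *)
Lemma triangle_inscribed (x1 y1 x2 y2 l : K) :
    l = b * (x1 * y2 - x2 * y1) -> l != 0 ->
  exists x y, let k := Q x1 y1 * Q x2 y2 * Q (x1 + x2) (y1 + y2) / l ^+ 2 in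
  [/\ Q x y = k, Q (x + x1) (y + y1) = k & Q (x + x2) (y + y2) = k].
Proof.
move=> lE l0; set q1 := Q x1 y1; set q2 := Q x2 y2.
exists (q2 / l * x1 + q1 / l * x2), (q2 / l * y1 + q1 / l * y2) => k.
have two0 : 1 + 1 = 0 :> K by rewrite addrr_pchar2.
(* [l'] is the polar form at the two vectors; it agrees with the determinant expression [l] only
   modulo 2. *)
pose l' := Q (x1 + x2) (y1 + y2) - q1 - q2.
have ll' : l' = l.
  have -> : l' = l + (1 + 1) * (a * x1 * x2 + c * y1 * y2 + b * x2 * y1).
    by rewrite /l' /q1 /q2 /Q lE; ring.
  by rewrite two0 mul0r addr0.
have Q12 : Q (x1 + x2) (y1 + y2) = q1 + q2 + l by rewrite -ll' /l'; ring.
have QD s1 s2 : Q (s1 * x1 + s2 * x2) (s1 * y1 + s2 * y2)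
    = q1 * s1 ^+ 2 + l * s1 * s2 + q2 * s2 ^+ 2.
  by rewrite -ll' /l' /q1 /q2 /Q; ring.
(* For the two translated points the identities hold modulo 2; [z] is half of the even part that
   vanishes. *)
have mod2 x y z : x = y + (1 + 1) * z -> x = y :> K.
  by rewrite two0 mul0r addr0.
rewrite /k Q12; split.
- rewrite QD; field; exact: l0.
- rewrite -[_ + x1](_ : (q2 / l + 1) * x1 + q1 / l * x2 = _); last by ring.
  rewrite -[_ + y1](_ : (q2 / l + 1) * y1 + q1 / l * y2 = _); last by ring.
  rewrite QD; apply: (mod2 _ _ (q1 * q2 / l + q1)); field; exact: l0.
- rewrite -[_ + x2](_ : q2 / l * x1 + (q1 / l + 1) * x2 = _); last by ring.
  rewrite -[_ + y2](_ : q2 / l * y1 + (q1 / l + 1) * y2 = _); last by ring.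
  rewrite QD; apply: (mod2 _ _ (q1 * q2 / l + q2)); field; exact: l0.
Qed.
End Triangle.

(** * Homogeneous coordinates of projective points *)

Section ProjectivePoints.
Local Open Scope ring_scope.
Variables (K : finFieldType) (d : nat).
Implicit Types (P : PG K d) (v w : 'rV[K]_(d.+1)).

Lemma coords_neq0 P v : coords P v -> v != 0.
Proof.
case: P => M MP /eqP /= Mv; move: MP; rewrite Mv mxrank_gen rank_rV.
by case/andP; case: (v != 0).
Qed.

Lemma exists_coords v : v != 0 -> exists P, coords P v.
Proof.
move=> v0; have vP : (\rank <<v>>%MS == 1)%N && (<<(<<v>>)>>%MS == <<v>>%MS).
  by rewrite mxrank_gen rank_rV v0 genmx_id eqxx.
by exists (Point vP); rewrite /coords.
Qed.

Lemma coords_inj P P' v : coords P v -> coords P' v -> P = P'.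
Proof. by move=> /eqP Pv /eqP P'v; apply: val_inj; rewrite /= Pv P'v. Qed.

Lemma coords_scale P v w : coords P v -> coords P w ->
  exists2 k, k != 0 & w = k *: v.
Proof.
move=> Pv Pw; have := coords_neq0 Pw; move: Pv Pw => /eqP Pv /eqP; rewrite Pv => /genmxP/andP[_].
case/sub_rVP => k ->; rewrite scaler_eq0 negb_or => /andP[k0 _].
by exists k.
Qed.

Lemma coordsZ P v k : k != 0 -> coords P v -> coords P (k *: v).
Proof.
move=> k0 /eqP Pv; apply/eqP; rewrite Pv; apply/genmxP.
by apply/eqmxP/eqmx_sym/eqmx_scale.
Qed.

End ProjectivePoints.

(** * Conics in characteristic 2: tangency to the line at infinity, and the nucleus *)

Section CentralForm.
Local Open Scope ring_scope.
Variable K : finFieldType.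
Implicit Type A : 'M[K]_3.

Lemma hom3D (x y z x' y' z' : K) :
  hom3 x y z + hom3 x' y' z' = hom3 (x + x') (y + y') (z + z').
Proof. by apply/rowP=> -[[|[|[]]] ?] //; rewrite !mxE. Qed.

Lemma hom3_exists (v : 'rV[K]_3) : exists x y z, v = hom3 x y z.
Proof.
exists (v 0 0), (v 0 1), (v 0 (lift 0 1)); apply/rowP=> -[[|[|[]]] ?] //;
  by rewrite !mxE /=; congr (v _ _); apply: val_inj.
Qed.

Lemma hom3_eq0 (x y z : K) : hom3 x y z = 0 -> [/\ x = 0, y = 0 & z = 0].
Proof.
move=> /rowP h; split.
- by have := h 0; rewrite !mxE.
- by have := h 1; rewrite !mxE.
- by have := h (lift 0 1); rewrite !mxE.
Qed.

Lemma hom3Z (k x y z : K) : k *: hom3 x y z = hom3 (k * x) (k * y) (k * z).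
Proof. by apply/rowP=> -[[|[|[]]] ?] //; rewrite !mxE. Qed.

Lemma quadZ A k (v : 'rV[K]_3) : quad A (k *: v) = k ^+ 2 * quad A v.
Proof. by rewrite /quad -scalemxAl -scalemxAl linearZ -scalemxAr !mxE; ring. Qed.

Lemma quad_hom3 A : exists a b c d e f, forall x y z : K,
  quad A (hom3 x y z) =
  a * x ^+ 2 + b * x * y + c * y ^+ 2 + d * x * z + e * y * z + f * z ^+ 2.
Proof.
pose i2 : 'I_3 := lift 0 1.
exists (A 0 0), (A 0 1 + A 1 0), (A 1 1).
exists (A 0 i2 + A i2 0), (A 1 i2 + A i2 1), (A i2 i2).
move=> x y z; rewrite /quad !mxE !big_ord_recl big_ord0 !mxE /=.
rewrite !big_ord_recl !big_ord0 !mxE /=.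
have e1 : lift ord0 ord0 = 1 :> 'I_3 by apply: val_inj.
have e2 : lift ord0 (lift ord0 ord0) = i2 :> 'I_3 by apply: val_inj.
by rewrite ?e2 ?e1; ring.
Qed.

Lemma det_mx22 (g : 'M[K]_2) :
  \det g = g 0 0 * g 1 1 - g 0 1 * g 1 0.
Proof.
rewrite (expand_det_row _ 0) !big_ord_recl big_ord0 /cofactor !det_mx11 !mxE /=.
rewrite addr0 expr0 mul1r expr1 mulN1r mulrN.
by congr (g _ _ * g _ _ - g _ _ * g _ _); apply: val_inj.
Qed.

Hypothesis pcharK : 2%N \in [pchar K].

Let mod2 (x y z : K) : x = y + (1 + 1) * z -> x = y.
Proof. by rewrite addrr_pchar2 // mul0r addr0. Qed.

(** In characteristic 2, a form without xy term restricts to the line at infinity as the square of a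
    linear form, whose only zero is the point (sqrt c, sqrt a, 0). *)
Lemma card_conic_linf A (a c d e f : K) : Defs.nondegenerate A ->
    (forall x y z, quad A (hom3 x y z) =
       a * x ^+ 2 + c * y ^+ 2 + d * x * z + e * y * z + f * z ^+ 2) ->
  #|[set P : PG K 2 | [exists v, coords P v && (quad A v == 0)]] :&: linf K| = 1%N.
Proof.
move=> ndA QA; have [ra ara] := sqrt_exists a pcharK.
have [rc crc] := sqrt_exists c pcharK.
(* If a = c = 0, then (e, d, 0) would be singular unless d = e = 0, and in that case (1, 0, 0) is
   singular. *)
have v0_n0 : hom3 rc ra 0 != 0.
  apply/eqP=> /hom3_eq0[rc0 ra0 _].
  have a0 : a = 0 by rewrite ara ra0 expr0n.
  have c0 : c = 0 by rewrite crc rc0 expr0n.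
  have /hom3_eq0[e0 d0 _] : hom3 e d 0 = 0.
    apply: ndA => [|w]; first by rewrite QA a0 c0; ring.
    have [x [y [z ->]]] := hom3_exists w; rewrite /polar hom3D !QA a0 c0.
    by apply: (mod2 (z := d * e * z)); ring.
  have /hom3_eq0[/eqP] : hom3 1 0 0 = 0 :> 'rV[K]_3; last by rewrite oner_eq0.
  apply: ndA => [|w]; first by rewrite QA a0 c0; ring.
  have [x [y [z ->]]] := hom3_exists w; rewrite /polar hom3D !QA a0 c0 e0 d0.
  by ring.
have [P0 P0v] := exists_coords v0_n0.
apply/eqP/cards1P; exists P0; apply/setP=> P; rewrite !inE.
apply/andP/eqP=> [[/existsP[v /andP[Pv /eqP Qv]] /existsP[x /existsP[y Pxy]]]|->].
  have [k _ e1] := coords_scale Pv Pxy.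
  have : quad A (hom3 x y 0) = 0 by rewrite e1 quadZ Qv mulr0.
  rewrite QA => Qxy.
  have /eqP : (ra * x - rc * y) ^+ 2 = 0.
    rewrite -Qxy ara crc; apply: (mod2 (z := - (ra * rc * x * y))); ring.
  rewrite expf_eq0 /= subr_eq0 => /eqP rxy.
  suff [l l0] : exists2 l, l != 0 & hom3 x y 0 = l *: hom3 rc ra 0.
    move=> exy; apply: coords_inj Pxy _; rewrite exy; exact: coordsZ.
  suff [l exy] : exists l, hom3 x y 0 = l *: hom3 rc ra 0.
    exists l => //; have := coords_neq0 Pxy.
    by rewrite exy scaler_eq0 negb_or => /andP[].
  have [ra0|ra0] := eqVneq ra 0; last first.
    exists (y / ra); rewrite hom3Z mulr0; congr hom3; last by field.
    by apply: (mulfI ra0); rewrite rxy; field.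
  have rc0 : rc != 0.
    apply: contraNneq v0_n0 => ->; rewrite ra0; apply/eqP/rowP.
    by move=> -[[|[|[]]] ?] //; rewrite !mxE.
  exists (x / rc); rewrite hom3Z mulr0; congr hom3; first by field.
  by apply: (mulfI rc0); rewrite -rxy ra0; ring.
split; last by apply/existsP; exists rc; apply/existsP; exists ra.
apply/existsP; exists (hom3 rc ra 0); rewrite P0v QA ara crc /=.
by apply/eqP/(mod2 (z := ra ^+ 2 * rc ^+ 2)); ring.
Qed.

(* In characteristic 2 the nucleus is an affine point, and translating it to
   the origin kills the linear terms. *)
Lemma conic_central_form A (a b c d e f : K) (g : 'M[K]_2) :
    Defs.nondegenerate A -> g \in unitmx -> b != 0 ->
    (forall x y z, quad A (hom3 x y z) =
       a * x ^+ 2 + b * x * y + c * y ^+ 2 + d * x * z + e * y * z + f * z ^+ 2) ->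
  exists (n : 'rV[K]_2) (a' b' c' k : K), [/\ b' != 0, k != 0 &
    forall x y, let v := n + hom2 x y *m g in
    quad A (hom3 (v 0 0) (v 0 1) 1) =
    k + (a' * x ^+ 2 + b' * x * y + c' * y ^+ 2)].
Proof.
move=> ndA gU b0 QA.
pose Q x y := a * x ^+ 2 + b * x * y + c * y ^+ 2.
(* The nucleus (e, d, b) spans the radical of the polar form. The new square coefficients are the
   values of Q at the rows of [g], and the new xy coefficient is b det g. *)
exists (hom2 (e / b) (d / b)), (Q (g 0 0) (g 0 1)),
  (b * (g 0 0 * g 1 1 - g 0 1 * g 1 0)), (Q (g 1 0) (g 1 1)),
  (quad A (hom3 (e / b) (d / b) 1)).
split.
- rewrite mulf_neq0 //; move: gU; rewrite unitmxE unitfE; apply: contraNneq => dg.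
  by rewrite det_mx22 dg.
(* The nucleus lies in the radical, so it would be singular if the form vanished there. *)
- apply/eqP=> k0; have /hom3_eq0[_ _ /eqP] : hom3 (e / b) (d / b) 1 = 0.
    apply: ndA => // w; have [x [y [z ->]]] := hom3_exists w.
    rewrite /polar hom3D !QA.
    apply: (mod2 (z := a * e / b * x + c * d / b * y + f * z
      + d * e / b * z + d * x + e * y)).
    by field.
  by rewrite oner_eq0.
- move=> x y v.
  have -> : v 0 0 = e / b + (x * g 0 0 + y * g 1 0).
    rewrite !mxE !big_ord_recl big_ord0 !mxE /= addr0.
    by congr (_ + (_ + _ * g _ _)); apply: val_inj.
  have -> : v 0 1 = d / b + (x * g 0 1 + y * g 1 1).
    rewrite !mxE !big_ord_recl big_ord0 !mxE /= addr0.
    by congr (_ + (_ + _ * g _ _)); apply: val_inj.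
  rewrite !QA /Q.
  move: (g 0 0) (g 0 1) (g 1 0) (g 1 1) => g00 g01 g10 g11.
  apply: (mod2 (z := (a * e / b + d) * (x * g00 + y * g10)
    + (c * d / b + e) * (x * g01 + y * g11)
    + x * y * (a * g00 * g10 + c * g01 * g11 + b * g01 * g10))).
  by field.
Qed.

End CentralForm.

(** * Rescaling the triangle to reach the prescribed level k *)

Section ThreePoints.
Local Open Scope ring_scope.
Variables (q t m : nat) (K : finFieldType).
Hypotheses (cardK : #|K| = (q ^ t)%N) (q_even : ~~ odd q) (q_gt3 : (3 < q)%N).
Hypotheses (t_gt2 : (2 < t)%N) (m_gt0 : (0 < m)%N) (mt : coprime m t).

Lemma conic_block_three_points (a b c k u : K) :
    b != 0 -> k != 0 -> u != 0 ->
    let Q x y := a * x ^+ 2 + b * x * y + c * y ^+ 2 in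
    let f v s := s ^+ (q ^ m) * v in
  exists v x y s1 s2, [/\ v != 0, Nm q t v = Nm q t u, s1 != 0, s2 != 0 & s1 != s2]
    /\ [/\ Q x y = k, Q (x + s1) (y + f v s1) = k & Q (x + s2) (y + f v s2) = k].
Proof.
move=> b0 k0 u0 Q f; have t_gt0 : (0 < t)%N by lia.
have p2 := pchar2_card_even cardK q_even t_gt0.
have [s1 [s2 []]] := exists_nonsingular_triangle cardK a c mt m_gt0 q_gt3 t_gt2 u0 b0.
pose h x := x ^+ (q ^ m) * u; rewrite -!/(Q _ _) -!/(h _) => Q1 Q2 + ind.
(* Additivity holds because q is a power of 2. *)
have -> : h (s1 + s2) = h s1 + h s2.
  rewrite /h /f exprDn_pchar ?mulrDl // (eq_pnat _ (pcharf_eq p2)) pnatX.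
  by rewrite (pnat_card_pchar cardK t_gt0 p2).
move=> Q12; pose l := b * (s1 * h s2 - s2 * h s1).
have l0 : l != 0 by rewrite mulf_neq0 // subr_eq0.
pose k1 := Q s1 (h s1) * Q s2 (h s2) * Q (s1 + s2) (h s1 + h s2) / l ^+ 2.
have k10 : k1 != 0 by rewrite !mulf_neq0 // invr_neq0 // expf_neq0.
have [r kr] := sqrt_exists (k / k1) p2.
have r0 : r != 0.
  apply: contraNneq k0 => r0; move/eqP: kr; rewrite r0 expr0n /=.
  by rewrite mulf_eq0 invr_eq0 (negPf k10) orbF.
(* The factor r^(1 - q^m) compensates for the power of r, so the block of [v] is r times the block
   of [u]. *)
pose v := u * r / r ^+ (q ^ m).
have fv x : f v (r * x) = r * h x.
  rewrite /h /f /v exprMn; move: (expf_neq0 (q ^ m) r0).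
  by move: (r ^+ (q ^ m)) (x ^+ (q ^ m)) => y z y0; field.
have QZ x y : Q (r * x) (r * y) = r ^+ 2 * Q x y by rewrite /Q; ring.
have r2l0 : r ^+ 2 * l != 0 by rewrite mulf_neq0 ?expf_neq0.
have lE : r ^+ 2 * l = b * ((r * s1) * (r * h s2) - (r * s2) * (r * h s1)).
  by rewrite /l; ring.
have [x [y]] := triangle_inscribed a c p2 lE r2l0; rewrite /= -!/(Q _ _).
(* The three values of Q contribute r^6 and the squared polar form r^4, so the level scales by
   r^2. *)
rewrite -!mulrDr !QZ; set k2 := _ / (r ^+ 2 * l) ^+ 2; have -> : k2 = k.
  have -> : k2 = r ^+ 2 * k1.
    rewrite /k2 /k1; move: (Q _ _) (Q _ _) (Q _ _) => z1 z2 z3; field.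
    by rewrite l0 r0.
  by rewrite -kr divfK.
move=> Qk; exists v, x, y, (r * s1), (r * s2); split; last by rewrite !fv.
have h0 : h 0 = 0.
  have qm0 : ((q ^ m)%N == 0%N) = false by rewrite expn_eq0; lia.
  by rewrite /h /f expr0n qm0 mul0r.
split.
- by rewrite /v !mulf_neq0 // invr_neq0 // expf_neq0.
- by rewrite (Nm_twist m cardK).
- by rewrite mulf_neq0 //; apply: contraNneq ind => ->; rewrite h0 mul0r mulr0.
- by rewrite mulf_neq0 //; apply: contraNneq ind => ->; rewrite h0 mul0r mulr0.
- by rewrite (inj_eq (mulfI r0)); apply: contraNneq ind => ->.
Qed.

End ThreePoints.

(** * Three collinear conic points in the André plane *)

Theorem theorem6 (q t : nat) (K : finFieldType)
    (cardK : #|K| = q ^ t) (q_even : ~~ odd q)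
    (t_ge3 : 3 <= t) (t_prime : prime t) (t_le_q : t <= q)
    (C : {set PG K 2}) (conicC : is_conic C)
    (D : {set PG K 1}) (andreD : is_andre_set q t D)
    (m : nat) (m_range : 1 <= m <= t.-1)
    (N : {set {set 'rV[K]_2}}) (netN : is_replacement_net q t D m N)
    (extsecC : exterior C (linf K) \/ secant C (linf K)) :
  ~ is_arc (andre_plane_lines D N) (andre_points_of C).
Proof.
have t_gt0 : 0 < t by lia.
have q_gt3 : 3 < q.
  have : q != 3 by apply: contraNneq q_even => ->.
  lia.
have m_gt0 : 0 < m by lia.
have mt : coprime m t.
  rewrite coprime_sym prime_coprime //; apply/negP => /dvdn_leq; lia.
have p2 := pchar2_card_even cardK q_even t_gt0.
case: conicC => A ndA defC.
have [a [b [c [d [e [f QA]]]]]] := quad_hom3 A.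
(* Without xy term the conic would be tangent to the line at infinity. *)
have b0 : (b != 0)%R.
  apply/eqP=> b0; have : #|C :&: linf K| = 1.
    rewrite defC; apply: (@card_conic_linf _ p2 A a c d e f) => // x y z.
    by rewrite QA b0; ring.
  by case: extsecC => ->.
case: netN => g [s [delta [gU _ _ defD defN]]].
have [n [a' [b' [c' [k [b'0 k0 Qv]]]]]] := conic_central_form p2 ndA gU b0 QA.
(* An orbit is nonempty, and any point of [D] exhibits [delta] as a norm. *)
have [u u0 Nu] : exists2 u : K, (u != 0)%R & Nm q t u = delta.
  case: andreD => E [F [P [H [_ _ _ _ defD']]]].
  have: P \in D by rewrite defD' orbit_refl.
  rewrite defD => /imsetP[P' + _]; rewrite inE => /existsP[u /and3P[u0 /eqP Nu _]].
  by exists u.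
have k0' : (- k != 0)%R by rewrite oppr_eq0.
have [v [x0 [y0 [s1 [s2 [[v0 Nv s10 s20 s12] [Q0 Q1 Q2]]]]]]] :=
  conic_block_three_points cardK q_even q_gt3 t_ge3 m_gt0 mt a' c' b'0 k0' u0.
(* These coordinates have their origin at the nucleus and use the frame [g] in which the replacement
   net is standard. *)
move=> arc; pose V x y := (n + hom2 x y *m g)%R.
have VC x y : (a' * x ^+ 2 + b' * x * y + c' * y ^+ 2 = - k)%R ->
    V x y \in affine_part C.
  move=> Qk; have w0 : hom3 (V x y 0 0)%R (V x y 0 1)%R 1%R != 0%R.
    by apply/eqP=> /hom3_eq0[_ _ /eqP]; rewrite oner_eq0.
  have [P Pw] := exists_coords w0; rewrite inE; apply/existsP; exists P.
  rewrite Pw andbT defC inE; apply/existsP.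
  by exists (hom3 (V x y 0 0)%R (V x y 0 1)%R 1%R); rewrite Pw Qv Qk subrr eqxx.
(* First coordinates alone separate the three points: they are x0, x0 + s1 and x0 + s2. *)
have V_inj x y x' y' : V x y = V x' y' -> x = x'.
  by move/addrI/(can_inj (mulmxK gU))/rowP/(_ 0%R); rewrite !mxE.
pose block := [set (w *m g)%R | w in andre_block q m v].
pose L := translate (V x0 y0) block.
(* The block of [v] belongs to the net because [v] has the same norm [delta] as [u]. *)
have LD : L \in andre_affine_lines D N.
  rewrite !inE; apply/orP; right; apply/existsP; exists (V x0 y0).
  apply/existsP; exists block; rewrite eqxx andbT defN.
  by apply/imset_f/imsetP; exists v; rewrite // inE v0 Nv Nu eqxx.
have VL s' : V (x0 + s')%R (y0 + s' ^+ (q ^ m) * v)%R \in L.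
  apply/imsetP; exists (hom2 s' (s' ^+ (q ^ m) * v) *m g)%R.
    by apply/imset_f/imsetP; exists s'.
  rewrite /V -addrA -mulmxDl; congr (_ + _ *m _)%R.
  by apply/rowP=> -[[|[]] ?] //; rewrite !mxE.
have VL0 : V x0 y0 \in L.
  have qm0 : (q ^ m == 0) = false by rewrite expn_eq0; lia.
  by have := VL 0%R; rewrite expr0n qm0 mul0r !addr0.
have Vx0 y y' s' : (s' != 0)%R -> V x0 y != V (x0 + s')%R y'.
  apply: contraNneq => /V_inj/eqP.
  by rewrite -subr_eq0 opprD addNKr oppr_eq0.
apply: (arc (inl (V x0 y0)) (inl (V (x0 + s1)%R (y0 + s1 ^+ (q ^ m) * v)%R))
            (inl (V (x0 + s2)%R (y0 + s2 ^+ (q ^ m) * v)%R))).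
- by apply/imset_f/VC.
- by apply/imset_f/VC.
- by apply/imset_f/VC.
- exact: Vx0.
- by apply: contraNneq s12 => -[/V_inj/addrI->].
- exact: Vx0.
exists (extended_line (andre_affine_lines D N) L).
  by rewrite inE; apply/orP; right; apply: imset_f.
by split; rewrite inE; apply/orP; right; apply: imset_f.
Qed.
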